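(* Let $\mathcal{P}=\langle\Sigma\mid\mathcal{R}\rangle$ be a semigroup presentation and $w\in\Sigma^+$ a base word. The transversality graph of the Squier complex $S(\mathcal{P},w)$ has no induced cycles of odd length greater than five.
   Context: A semigroup presentation $\mathcal{P}=\langle\Sigma\mid\mathcal{R}\rangle$ consists of an alphabet $\Sigma$ and a set $\mathcal{R}$ of relations $u=v$ with $u,v\in\Sigma^+$. Here $\Sigma^+$ is the free semigroup of non-empty words and $\Sigma^*=\Sigma^+\cup\{1\}$ also contains the empty word $1$. Convention: if $u=v\in\mathcal{R}$ then $v=u\notin\mathcal{R}$ (in particular $u=u\notin\mathcal{R}$). The Squier complex $S(\mathcal{P})$ is the cube complex whose vertices are the words over $\Sigma$; whose oriented edges are $(a,u\to v,b)$ with $a,b\in\Sigma^*$ and $u=v$ or $v=u$ in $\mathcal{R}$, going from $aub$ to $avb$ (and $(a,v\to u,b)$ is the same edge with opposite orientation); and whose $n$-cubes are similarly $(a_1,u_1\to v_1,\dots,a_n,u_n\to v_n,a_{n+1})$, spanned by the vertices $a_1w_1\cdots a_nw_na_{n+1}$ with $w_i\in\{u_i,v_i\}$. $S(\mathcal{P},w)$ is the connected component containing $w$. A hyperplane is an equivalence class of edges for the equivalence relation generated by: two edges are equivalent if they are parallel sides of some square. Two hyperplanes are transverse if there are edges belonging to them, respectively, that are non-parallel sides of some square. The transversality graph of a cube complex has the hyperplanes as vertices, and its edges link two (distinct) transverse hyperplanes. A subgraph $\Gamma\subset\Lambda$ is induced if any two vertices of $\Gamma$ are linked by an edge in $\Lambda$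 if and only if they are linked by an edge in $\Gamma$. *)

(* Defs.v *)
From Stdlib Require Import List Relations.
From mathcomp Require Import all_boot.
From mathcomp Require Import boolp classical_sets.

Set Implicit Arguments.
Unset Strict Implicit.
Unset Printing Implicit Defensive.

Local Open Scope classical_set_scope.

(** ** Graphs and induced cycles *)

Record graph := Graph {
  vert :> Type;
  link : vert -> vert -> Prop;
  link_sym : forall x y, link x y -> link y x;
  link_irrefl : forall x, ~ link x x }.

Record subgraph (L : graph) := Subgraph {
  sub_vert : set L;
  sub_link : L -> L -> Prop;
  sub_link_sym : forall x y, sub_link x y -> sub_link y x;
  sub_link_vert : forall x y, sub_link x y -> sub_vert x /\ sub_vert y;
  sub_link_sub : forall x y, sub_link x y -> link x y }.

Definition induced (L : graph) (G : subgraph L) : Prop :=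
  forall x y, sub_vert G x -> sub_vert G y -> (link x y <-> sub_link G x y).

Definition is_cycle (L : graph) (G : subgraph L) (n : nat) : Prop :=
  2 < n /\
  exists c : 'I_n -> L,
    [/\ injective c,
        range c = sub_vert G
      & forall i j : 'I_n,
          sub_link G (c i) (c j) <->
          (j == i.+1 %[mod n]) || (i == j.+1 %[mod n])].

(** ** Semigroup presentations *)

Definition word (Sigma : Type) := seq Sigma.

Record presentation (Sigma : Type) := Presentation {
  rel : word Sigma -> word Sigma -> Prop;
  rel_nonempty : forall u v, rel u v -> u <> [::] /\ v <> [::];
  rel_asym : forall u v, rel u v -> ~ rel v u }.

Section SquierComplex.
Variables (Sigma : Type) (P : presentation Sigma).
Local Notation word := (word Sigma).

(** The (oriented) cube (a_1, u_1 -> v_1, ..., a_n, u_n -> v_n, a_{n+1}) is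
    encoded as ([:: (a_1, u_1, v_1); ...; (a_n, u_n, v_n)], a_{n+1}). *)
Definition cube := (seq (word * word * word) * word)%type.

Definition is_cube (n : nat) (q : cube) : Prop :=
  size q.1 = n /\
  List.Forall (fun '(_, u, v) => rel P u v \/ rel P v u) q.1.

(** The vertex a_1 w_1 ... a_n w_n a_{n+1}, where w_i is v_i if [eps i] holds
    and u_i otherwise (positions are counted from 0). *)
Fixpoint corner_rec (s : seq (word * word * word)) (t : word)
    (eps : nat -> bool) : word :=
  match s with
  | [::] => t
  | (a, u, v) :: s' =>
      a ++ (if eps 0 then v else u) ++ corner_rec s' t (fun i => eps i.+1)
  end.

Definition corner (q : cube) (eps : nat -> bool) : word :=
  corner_rec q.1 q.2 eps.

Definition source (e : cube) : word := corner e (fun=> false).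
Definition target (e : cube) : word := corner e (fun=> true).

Definition prepend (a : word) (q : cube) : cube :=
  match q with
  | ([::], t) => ([::], a ++ t)
  | ((a', u, v) :: s, t) => ((a ++ a', u, v) :: s, t)
  end.

(** The codimension-one face obtained by replacing the factor u_i -> v_i by
    the word v_i if [b] holds and by u_i otherwise, which is then merged with
    its neighbours a_i and a_{i+1}. *)
Fixpoint face_rec (s : seq (word * word * word)) (t : word)
    (i : nat) (b : bool) : cube :=
  match s, i with
  | [::], _ => ([::], t)
  | (a, u, v) :: s', 0 => prepend (a ++ (if b then v else u)) (s', t)
  | f :: s', i'.+1 => let q := face_rec s' t i' b in (f :: q.1, q.2)
  end.

Definition face (i : nat) (b : bool) (q : cube) : cube :=
  face_rec q.1 q.2 i b.

Definition adjacent (x y : word) : Prop :=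
  exists e, [/\ is_cube 1 e, source e = x & target e = y].

Definition connected : word -> word -> Prop :=
  clos_refl_sym_trans word adjacent.

(** The n-cubes of the component S(P, w). *)
Definition squier_cube (w : word) (n : nat) (q : cube) : Prop :=
  is_cube n q /\ forall eps, connected w (corner q eps).

(** The same edge with the opposite orientation. *)
Definition reverse (e : cube) : cube :=
  ([seq (auv.1.1, auv.2, auv.1.2) | auv <- e.1], e.2).

(** The sides of a square are its faces [face i b q] with [i < 2]; two of them
    are parallel exactly when they share the same index [i]. *)
Definition parallel_sides (w : word) (e e' : cube) : Prop :=
  exists q i, [/\ squier_cube w 2 q, i < 2,
                  e = face i false q & e' = face i true q].

Definition same_edge (w : word) (e e' : cube) : Prop :=
  squier_cube w 1 e /\ e' = reverse e.

Definition same_hyperplane (w : word) : cube -> cube -> Prop :=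
  clos_refl_sym_trans cube
    (fun e e' => parallel_sides w e e' \/ same_edge w e e').

(** Hyperplanes are sets of oriented edges closed under reversal, which is the
    same as sets of unoriented edges. *)
Definition is_hyperplane (w : word) (H : set cube) : Prop :=
  exists2 e, squier_cube w 1 e & H = [set e' | same_hyperplane w e e'].

Definition hyperplane (w : word) : Type := {H : set cube | is_hyperplane w H}.

Definition transverse (w : word) (H K : hyperplane w) : Prop :=
  exists q b b',
    squier_cube w 2 q /\
    ((sval H (face 0 b q) /\ sval K (face 1 b' q)) \/
     (sval K (face 0 b q) /\ sval H (face 1 b' q))).

Definition transversality_link (w : word) (H K : hyperplane w) : Prop :=
  H <> K /\ transverse H K.

Lemma transversality_link_sym w (H K : hyperplane w) :
  transversality_link H K -> transversality_link K H.
Proof.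
move=> [neqHK [q [b [b' [sq HK]]]]]; split; first by move/esym.
by exists q, b, b'; split=> //; case: HK; [right|left].
Qed.

Lemma transversality_link_irrefl w (H : hyperplane w) :
  ~ transversality_link H H.
Proof. by case. Qed.

Definition transversality_graph (w : word) : graph :=
  Graph (@transversality_link_sym w) (@transversality_link_irrefl w).

End SquierComplex.

(* Main.v *)
(** A hyperplane is determined by the triple ([a], {u, v}, [b]), where (a, u -> v, b)
    is any of its edges and brackets denote classes modulo the presentation.  Hence
    "H is on the left of K in some square" is a transitive relation, and two distinct
    hyperplanes are linked exactly when this relation compares them.  Along an induced
    cycle of length at least four, transitivity forces consecutive edges to be oriented
    in opposite directions, so the length is even. *)

Require Import Defs.
From Stdlib Require Import List Relations.
From mathcomp Require Import all_boot.
From mathcomp Require Import boolp classical_sets.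

Set Implicit Arguments.
Unset Strict Implicit.
Unset Printing Implicit Defensive.

(** * Induced cycles in graphs defined by a transitive relation *)

Lemma no_induced_odd_cycle (L : graph) (R : L -> L -> Prop) (n : nat) :
    (forall x y z, R x y -> R y z -> R x z) ->
    (forall x y : L, link x y <-> x <> y /\ (R x y \/ R y x)) ->
    odd n -> 3 < n ->
  ~ exists G : subgraph L, induced G /\ is_cycle G n.
Proof.
move=> Rtr linkE n_odd n_gt3 [G [indG [_ [c [c_inj c_range cE]]]]].
case: n n_odd n_gt3 c c_inj c_range cE => // m m_odd m_gt3 c c_inj c_range cE.
(* The cycle is unrolled into a periodic sequence indexed by all naturals, so that no wrap-around
   case arises. *)
pose x k := c (inord (k %% m.+1)).
have val_x k : (inord (k %% m.+1) : 'I_m.+1) = k %% m.+1 :> nat.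
  by rewrite inordK // ltn_mod.
have modS k : (k %% m.+1).+1 = k.+1 %[mod m.+1] by rewrite -addn1 modnDml addn1.
have xP k : sub_vert G (x k) by rewrite -c_range; exists (inord (k %% m.+1)).
have link_x i j :
    link (x i) (x j) <-> (j == i.+1 %[mod m.+1]) || (i == j.+1 %[mod m.+1]).
  by rewrite (indG _ _ (xP i) (xP j)) cE !val_x !modS !modn_mod.
have x_neq2 k : x k <> x k.+2.
  move=> /c_inj/(congr1 val) /=; rewrite !val_x => /eqP.
  rewrite -{1}[k]addn0 -(addn2 k) eqn_modDl mod0n modn_small //.
  by apply: leq_trans m_gt3.
(* A link here would make 1 or 3 vanish modulo the length, which exceeds 3. *)
have nlink2 k : ~ link (x k) (x k.+2).
  case/link_x/orP.
    rewrite -(addn1 k.+1) -{2}[k.+1]addn0 eqn_modDl mod0n modn_small //.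
    by apply: leq_trans m_gt3.
  by rewrite -(addn3 k) -{1}[k]addn0 eqn_modDl mod0n modn_small.
pose d k := `[< R (x k) (x k.+1) >].
have dS k : d k.+1 = ~~ d k.
  have [_ Rk] : x k <> x k.+1 /\ (R (x k) (x k.+1) \/ R (x k.+1) (x k)).
    by apply/linkE/link_x; rewrite eqxx.
  have [_ RSk] : x k.+1 <> x k.+2 /\
      (R (x k.+1) (x k.+2) \/ R (x k.+2) (x k.+1)).
    by apply/linkE/link_x; rewrite eqxx.
  (* If two consecutive edges had the same direction, transitivity would compare [x k] with [x k.+2]
     and create a chord. *)
  rewrite /d; case: asboolP => h1; case: asboolP => h0 //; exfalso.
    by apply: (nlink2 k); apply/linkE; split=> //; left; apply: Rtr h0 h1.
  case: Rk => // Rk; case: RSk => // RSk.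
  by apply: (nlink2 k); apply/linkE; split=> //; right; apply: Rtr RSk Rk.
have dE k : d k = odd k (+) d 0 by elim: k => //= k IH; rewrite dS IH addNb.
have x_per k : x (m.+1 + k) = x k by rewrite /x modnDl.
(* Going once around the cycle flips [d] an odd number of times, yet returns to the same edge. *)
have : d (m.+1 + 0) = d 0 by rewrite /d -addnS !x_per.
by rewrite dE addn0 m_odd; case: (d 0).
Qed.

(** * Connectedness, edges and squares of the Squier complex *)

Section SquierComplex.
Variables (Sigma : Type) (P : presentation Sigma).
Local Notation word := (word Sigma).
Local Notation "x ~ y" := (connected P x y) (at level 70).
Implicit Types (a b u v x y z w : word) (e : cube Sigma).

Definition edge a u v b : cube Sigma := ([:: (a, u, v)], b).
Definition square a u v y r s b : cube Sigma := ([:: (a, u, v); (y, r, s)], b).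

Lemma connected_refl x : x ~ x. Proof. exact: rst_refl. Qed.

Lemma connected_sym x y : x ~ y -> y ~ x. Proof. exact: rst_sym. Qed.

Lemma connected_trans y x z : x ~ y -> y ~ z -> x ~ z.
Proof. exact: rst_trans. Qed.

Hint Resolve connected_refl : core.

Lemma connected_ctx a b x y : x ~ y -> a ++ x ++ b ~ a ++ y ++ b.
Proof.
elim=> [{}x {}y [[s t] [[/= sz sP] <- <-]] | {}x | {}x {}y _ | {}x {}y z _ IH1 _ IH2].
- apply: rst_step; case: s sz sP => [|[[a' u] v] []] //= _ sP.
  have uv := Forall_inv sP.
  exists (edge (a ++ a') u v (t ++ b)).
  split; rewrite /source /target /corner /= -?catA //.
  by split=> //; constructor.
- exact: connected_refl.
- exact: connected_sym.
- exact: connected_trans IH1 IH2.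
Qed.

Lemma connected_cat x x' y y' : x ~ x' -> y ~ y' -> x ++ y ~ x' ++ y'.
Proof.
move=> xx' yy'; apply: (@connected_trans (x' ++ y)).
  exact: (connected_ctx [::]).
by have := connected_ctx x' [::] yy'; rewrite !cats0.
Qed.

Lemma connected_rel u v : Defs.rel P u v \/ Defs.rel P v u -> u ~ v.
Proof.
move=> uv; apply: rst_step; exists (edge [::] u v [::]).
split; rewrite /source /target /corner /= ?cats0 //.
by split=> //; constructor.
Qed.

Lemma connected_if (c : bool) u v : u ~ v -> (if c then v else u) ~ u.
Proof. by case: c => // /connected_sym. Qed.

Lemma connected_ifr (c : bool) u v : u ~ v -> u ~ (if c then v else u).
Proof. by case: c. Qed.

Hint Resolve connected_cat connected_rel connected_if connected_ifr : core.

(** All corners of a cube are connected to each other, since [u ~ v] for each relation; lying in the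
    component of [w] can thus be tested at one corner. *)
Lemma squier_edgeP w a u v b :
  squier_cube P w 1 (edge a u v b) <->
  (Defs.rel P u v \/ Defs.rel P v u) /\ w ~ a ++ u ++ b.
Proof.
split=> [[[_ sP] /(_ (fun=> false))] ? | [uv wab]].
  by split=> //; apply: Forall_inv sP.
split=> [|eps]; first by split=> //; constructor.
apply: connected_trans wab _; rewrite /corner /=.
by auto 10.
Qed.

Lemma squier_squareP w a u v y r s b :
  squier_cube P w 2 (square a u v y r s b) <->
  [/\ Defs.rel P u v \/ Defs.rel P v u, Defs.rel P r s \/ Defs.rel P s r
    & w ~ a ++ u ++ y ++ r ++ b].
Proof.
split=> [[[_ uvrs] /(_ (fun=> false))] ? | [uv rs wab]].
  split=> //; first exact: Forall_inv uvrs.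
  exact: Forall_inv (Forall_inv_tail uvrs).
split=> [|eps]; first by split=> //; apply: List.Forall_cons => //; constructor.
apply: connected_trans wab _; rewrite /corner /=.
by auto 10.
Qed.

Lemma squier_square w q : squier_cube P w 2 q ->
  exists a u v y r s b, q = square a u v y r s b.
Proof.
move=> [[]]; case: q => [[|[[a u] v] [|[[y r] s] []]] b] //= _ _ _.
by exists a, u, v, y, r, s, b.
Qed.

(** [face 0] collapses the left factor, so it is an edge labelled by the right one. *)
Lemma face0_square c a u v y r s b :
  face 0 c (square a u v y r s b) = edge (a ++ (if c then v else u) ++ y) r s b.
Proof. by rewrite /face /= -catA. Qed.

Lemma face1_square c a u v y r s b :
  face 1 c (square a u v y r s b) = edge a u v (y ++ (if c then s else r) ++ b).
Proof. by rewrite /face /= -catA. Qed.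

(** The default value is irrelevant: this is only used on edges. *)
Definition factor e : word * word * word := head ([::], [::], [::]) e.1.

(** * Hyperplanes and types of edges *)

Definition same_type e e' : Prop :=
  [/\ (factor e).1.1 ~ (factor e').1.1, e.2 ~ e'.2
    & ((factor e).1.2 = (factor e').1.2 /\ (factor e).2 = (factor e').2) \/
      ((factor e).1.2 = (factor e').2 /\ (factor e).2 = (factor e').1.2)].

(** Parallel sides of a square differ only in a context, where one side of a relation replaces the
    other; reversal only swaps [u] and [v]. *)
Lemma same_hyperplane_type w e e' : same_hyperplane P w e e' -> same_type e e'.
Proof.
elim=> [{}e {}e' [[q [i [sq i2 -> ->]]] | [[[sz _] _] ->]]
  | {}e | {}e {}e' _ [ha hb huv] | e1 e2 e3 _ [ha hb huv] _ [ha' hb' huv']].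
- have [a [u [v [y [r [s [b Eq]]]]]]] := squier_square sq; subst q.
  have /squier_squareP[/connected_rel uv /connected_rel rs _] := sq.
  case: i i2 => [|[|//]] _.
    rewrite !face0_square; split=> //=; last by left.
    by auto 10.
  rewrite !face1_square; split=> //=; last by left.
  by auto 10.
- by case: e sz => [[|[[a u] v] []] b] //= _; split=> //; right.
- by split=> //; left.
- split; [exact: connected_sym | exact: connected_sym |].
  by case: huv => -[-> ->]; [left | right].
- split; [exact: connected_trans ha ha' | exact: connected_trans hb hb' |].
  by case: huv => -[-> ->]; case: huv' => -[-> ->]; [left | right | right | left].
Qed.

(** An elementary step [r -> s] inside [b] spans, together with [u -> v], a square whose parallel
    sides are the edges before and after the step. *)
Lemma same_hyperplane_right w a u v b b' :
  b ~ b' -> squier_cube P w 1 (edge a u v b) ->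
  same_hyperplane P w (edge a u v b) (edge a u v b').
Proof.
(* The symmetric and transitive cases need the intermediate edges to lie in the component of [w]. *)
have sq x y : x ~ y ->
    squier_cube P w 1 (edge a u v x) -> squier_cube P w 1 (edge a u v y).
  move=> xy /squier_edgeP[uv wx]; apply/squier_edgeP; split=> //.
  by apply: connected_trans wx _; auto 10.
elim=> [x y [[s t] [[/= sz sP] <- <-]] | x _ | x y xy IH /(sq _ _ (connected_sym xy)) sx
  | x y z xy IH1 _ IH2 sx].
- case: s sz sP => [|[[c r] s] []] //= _ sP /squier_edgeP[uv wE].
  have rs := Forall_inv sP.
  apply: rst_step; left; exists (square a u v c r s t), 1.
  by split; rewrite ?face1_square //; apply/squier_squareP.
- exact: rst_refl.
- exact: rst_sym (IH sx).
- exact: rst_trans (IH1 sx) (IH2 (sq _ _ xy sx)).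
Qed.

Lemma same_hyperplane_left w a a' u v b :
  a ~ a' -> squier_cube P w 1 (edge a u v b) ->
  same_hyperplane P w (edge a u v b) (edge a' u v b).
Proof.
have sq x y : x ~ y ->
    squier_cube P w 1 (edge x u v b) -> squier_cube P w 1 (edge y u v b).
  move=> xy /squier_edgeP[uv wx]; apply/squier_edgeP; split=> //.
  by apply: connected_trans wx _; apply: connected_cat.
elim=> [x y [[s t] [[/= sz sP] <- <-]] | x _ | x y xy IH /(sq _ _ (connected_sym xy)) sx
  | x y z xy IH1 _ IH2 sx].
- case: s sz sP => [|[[c r] s] []] //= _ sP /squier_edgeP[uv wE].
  have rs := Forall_inv sP.
  apply: rst_step; left; exists (square c r s t u v b), 0.
  split; rewrite ?face0_square //; apply/squier_squareP; split=> //.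
  by move: wE; rewrite /source /corner /= -!catA.
- exact: rst_refl.
- exact: rst_sym (IH sx).
- exact: rst_trans (IH1 sx) (IH2 (sq _ _ xy sx)).
Qed.

(** * The left-to-right relation between hyperplanes *)

Lemma hyperplane_same w (H : hyperplane P w) e e' :
  sval H e -> sval H e' -> same_hyperplane P w e e'.
Proof.
have [e0 _ ->] := svalP H => /= h h'.
by apply: rst_trans h'; apply: rst_sym.
Qed.

Lemma hyperplane_closed w (H : hyperplane P w) e e' :
  same_hyperplane P w e e' -> sval H e -> sval H e'.
Proof. by have [e0 _ ->] := svalP H => /= ee' h; apply: rst_trans ee'. Qed.

(** [face 1] collapses the right factor, so [H] is the hyperplane of the left one. *)
Definition precedes w (H K : hyperplane P w) : Prop :=
  exists q c c', [/\ squier_cube P w 2 q, sval H (face 1 c q) & sval K (face 0 c' q)].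

Lemma transverse_precedes w (H K : hyperplane P w) :
  transverse H K <-> precedes H K \/ precedes K H.
Proof.
split=> [[q [c [c' [sq [[h k] | [k h]]]]]] | [[q [c [c' [sq h k]]]] | [q [c [c' [sq k h]]]]]].
- by right; exists q, c', c.
- by left; exists q, c', c.
- by exists q, c', c; split=> //; right.
- by exists q, c', c; split=> //; left.
Qed.

(** The edges of [K] in the two squares have the same type, so the left context in the first square,
    where [H] acts, can be glued to the right context in the second, where [L] acts. *)
Lemma precedes_trans w (H K L : hyperplane P w) :
  precedes H K -> precedes K L -> precedes H L.
Proof.
move=> [q [c1 [c2 [sq hH hK]]]] [q' [c3 [c4 [sq' hK' hL]]]].
have [a [u [v [y [p [p' [d Eq]]]]]]] := squier_square sq; subst q.
have [a' [r [r' [z [s [s' [f Eq]]]]]]] := squier_square sq'; subst q'.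
have /squier_squareP[uv pp' wq] := sq.
have /squier_squareP[rr' ss' wq'] := sq'.
move: hH hK hK' hL; rewrite !(face0_square, face1_square) => hH hK hK' hL.
have [/= aa' dd' pr] := same_hyperplane_type (hyperplane_same hK hK').
have uvC := connected_rel uv; have ppC := connected_rel pp'.
have rrC := connected_rel rr'; have ssC := connected_rel ss'.
have prC : p ~ r.
  by case: pr => -[-> _] //; apply: connected_sym.
(* Up to connectedness, the part to the right of [K] in the first square contains the factor of
   [L]. *)
have dC : d ~ z ++ s ++ f.
  apply: connected_trans dd' _.
  by auto 10.
have aC : a' ~ a ++ u ++ y.
  apply: connected_trans (connected_sym aa') _.
  by auto 10.
have wN : w ~ a ++ u ++ (y ++ p ++ z) ++ s ++ f.
  apply: connected_trans wq _; rewrite -!catA.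
  by auto 10.
(* The factor [p] of [K] is frozen inside the middle word, between [y] from the first square and [z]
   from the second. *)
exists (square a u v (y ++ p ++ z) s s' f), false, false.
split; first exact/squier_squareP.
- rewrite face1_square; apply: hyperplane_closed hH.
  apply: same_hyperplane_right; first by rewrite -!catA; auto 10.
  apply/squier_edgeP; split=> //; apply: connected_trans wq _.
  by auto 10.
- rewrite face0_square; apply: hyperplane_closed hL.
  apply: same_hyperplane_left.
    have -> : a ++ u ++ y ++ p ++ z = (a ++ u ++ y) ++ p ++ z by rewrite -!catA.
    apply: connected_cat => //; apply: connected_cat => //.
    by apply: connected_trans (connected_sym prC); apply: connected_if.
  apply/squier_edgeP; split=> //; apply: connected_trans wq' _; rewrite -!catA.
  by auto 10.
Qed.

End SquierComplex.

Theorem corollary4p5 (Sigma : Type) (P : presentation Sigma) (w : word Sigma)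
    (hw : w <> [::]) (n : nat) (hodd : odd n) (hn : 5 < n) :
  ~ exists G : subgraph (transversality_graph P w), induced G /\ is_cycle G n.
Proof.
apply: (@no_induced_odd_cycle (transversality_graph P w) (@precedes Sigma P w)) hodd _.
- exact: precedes_trans.
- by move=> H K; rewrite -transverse_precedes.
- exact: leq_trans hn.
Qed.
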